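(* Let $N\ge 1$, let $a,u\in C(I)$ and $y_0\in\mathbb{C}$, where $I=[-1,1]$. Suppose $y\in C(I)$ solves the initial value problem $\dot y(t)=a(t)y(t)+u(t)$ on $I$, $y(-1)=y_0$. Suppose $p\in\mathcal{P}_N$ is the polynomial computed by the collocation algorithm, i.e. $p$ satisfies $$\dot p(t_j)=a(t_j)p(t_j)+u(t_j),\quad 0\le j\le N-1,\qquad p(-1)=y_0.$$ Let $$C_a=\exp\left(\int_{-1}^1\max\{\operatorname{Re} a(s),0\}\,ds\right),\qquad R_p=\dot p(-1)-a(-1)y_0-u(-1).$$ Then $$\|y-p\|_\infty\le 2C_a\Big(\|ap-I_N(ap)\|_\infty+\|u-I_N(u)\|_\infty+|R_p|\Big).$$
   Context: $I=[-1,1]$; $C(I)$ is the space of continuous complex-valued functions on $I$ with $\|f\|_\infty=\max_{t\in I}|f(t)|$. $\mathcal{P}_N$ is the space of polynomials of degree at most $N$ with complex coefficients. The Chebyshev collocation points are $t_j=\cos(\pi j/N)$, $j=0,\dots,N$ (so $t_0=1$, $t_N=-1$). For $f\in C(I)$, $I_N(f)\in\mathcal{P}_N$ is the unique polynomial of degree at most $N$ with $I_N(f)(t_j)=f(t_j)$ for $j=0,\dots,N$. A dot denotes $d/dt$. *)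

(* Defs.v *)
From Stdlib Require Import Reals Lra Lia ClassicalEpsilon FunctionalExtensionality.
From Coquelicot Require Import Coquelicot.
Open Scope R_scope.

(** A function on [[-1,1]] is represented by a total function [R -> C] whose
    values outside the interval are irrelevant. *)
Definition I11 (t : R) : Prop := -1 <= t <= 1.

(** Derivative relative to [D]: Coquelicot's [is_derive] with the filter
    [locally t] restricted to [D]; one-sided at the endpoints of an interval. *)
Definition is_derive_on (D : R -> Prop) (f : R -> C) (t : R) (l : C) : Prop :=
  filterdiff (K := R_AbsRing) (U := R_NormedModule) (V := C_R_NormedModule)
    f (within D (locally t)) (fun h : R => scal h l).

(** The supremum is attained when [f] is continuous on [[-1,1]]. *)
Definition norm_sup (f : R -> C) : R :=
  real (Lub_Rbar (fun r => exists t, I11 t /\ r = Cmod (f t))).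

Definition is_poly (n : nat) (p : R -> C) : Prop :=
  exists c : nat -> C,
    forall t : R, p t = sum_n (fun k => (c k * RtoC t ^ k)%C) n.

Definition cheb_pt (N j : nat) : R := cos (PI * INR j / INR N).

Definition is_interp (N : nat) (f q : R -> C) : Prop :=
  is_poly N q /\
  forall j : nat, (j <= N)%nat -> q (cheb_pt N j) = f (cheb_pt N j).

Local Open Scope C_scope.

(* Coquelicot's [sum_n] lives in [C_AbelianMonoid], where [ring] is blind. *)
Local Ltac cring :=
  match goal with |- @eq _ ?x ?y => change (@eq C x y) end; ring.

Lemma is_poly_S (n : nat) (p : R -> C) :
  is_poly (S n) p <->
  exists (c : C) (q : R -> C),
    is_poly n q /\ forall t, p t = c + RtoC t * q t.
Proof.
assert (shift : forall (c : nat -> C) t n,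
  sum_n (fun k => c k * RtoC t ^ k) (S n)
  = c O + RtoC t * sum_n (fun k => c (S k) * RtoC t ^ k) n).
{ intros c t m; induction m as [|m IH].
  - rewrite sum_Sn, !sum_O; change plus with Cplus; simpl; cring.
  - rewrite sum_Sn, IH, sum_Sn; change plus with Cplus.
    rewrite !Cpow_S; cring. }
split.
- intros [c Hc].
  exists (c O), (fun t => sum_n (fun k => c (S k) * RtoC t ^ k) n); split.
  + now exists (fun k => c (S k)).
  + intros t; rewrite Hc; apply shift.
- intros [c [q [[d Hd] Hp]]].
  exists (fun k => match k with O => c | S k' => d k' end); intros t.
  now rewrite shift, Hp, Hd.
Qed.

Lemma is_poly_0 (p : R -> C) : is_poly 0 p <-> exists c : C, forall t, p t = c.
Proof.
split.
- intros [c Hc]; exists (c O); intros t; rewrite Hc, sum_O; simpl; cring.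
- intros [c Hc]; exists (fun _ => c); intros t.
  rewrite Hc, sum_O; simpl; cring.
Qed.

Lemma is_poly_lin (n : nat) (c : C) (p q : R -> C) :
  is_poly n p -> is_poly n q -> is_poly n (fun t => p t + c * q t).
Proof.
revert p q; induction n as [|n IH]; intros p q.
- rewrite !is_poly_0; intros [a Ha] [b Hb].
  exists (a + c * b); intros t; now rewrite Ha, Hb.
- rewrite !is_poly_S; intros [a [p' [Pp Ha]]] [b [q' [Pq Hb]]].
  exists (a + c * b), (fun t => p' t + c * q' t); split.
  + now apply IH.
  + intros t; rewrite Ha, Hb; ring.
Qed.

Lemma is_poly_up (n : nat) (p : R -> C) : is_poly n p -> is_poly (S n) p.
Proof.
revert p; induction n as [|n IH]; intros p.
- rewrite is_poly_S, is_poly_0; intros [c Hc].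
  exists c, (fun _ => 0); split.
  + rewrite is_poly_0; now exists 0.
  + intros t; rewrite Hc; ring.
- intros H; apply is_poly_S in H; destruct H as [c [q [Pq Hq]]].
  apply is_poly_S; exists c, q; auto.
Qed.

Lemma is_poly_mul (n : nat) (x : R) (p : R -> C) :
  is_poly n p -> is_poly (S n) (fun t => (RtoC t - RtoC x) * p t).
Proof.
intros Pp.
assert (H : is_poly (S n) (fun t => RtoC t * p t)).
{ apply is_poly_S; exists 0, p; split; [easy|intros t; ring]. }
generalize (is_poly_lin _ (- RtoC x) _ _ H (is_poly_up _ _ Pp)).
intros [c Hc]; exists c; intros t; rewrite <- Hc; ring.
Qed.

Lemma is_poly_factor (n : nat) (x : R) (p : R -> C) :
  is_poly (S n) p ->
  exists q, is_poly n q /\ forall t, p t - p x = (RtoC t - RtoC x) * q t.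
Proof.
revert p; induction n as [|n IH]; intros p H; apply is_poly_S in H;
  destruct H as [c [q [Pq Hp]]].
- apply is_poly_0 in Pq as [d Hd].
  exists (fun _ => d); split.
  + apply is_poly_0; now exists d.
  + intros t; rewrite !Hp, !Hd; ring.
- destruct (IH q Pq) as [r [Pr Hr]].
  exists (fun t => q t + RtoC x * r t); split.
  + apply is_poly_lin; [easy|now apply is_poly_up].
  + intros t; rewrite !Hp.
    replace (c + RtoC t * q t - (c + RtoC x * q x))
      with ((RtoC t - RtoC x) * q t + RtoC x * (q t - q x)) by ring.
    rewrite Hr; ring.
Qed.

Lemma RtoC_sub_neq0 (x y : R) : x <> y -> RtoC x - RtoC y <> 0.
Proof.
intros H; rewrite <- RtoC_minus; intros E; apply H.
apply RtoC_inj in E; lra.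
Qed.

Lemma is_poly_zero (n : nat) (x : nat -> R) (p : R -> C) :
  (forall i j, (i < j <= n)%nat -> x i <> x j) ->
  is_poly n p -> (forall j, (j <= n)%nat -> p (x j) = 0) -> forall t, p t = 0.
Proof.
revert p; induction n as [|n IH]; intros p Hx Pp Hz t.
- apply is_poly_0 in Pp as [c Hc].
  now rewrite Hc, <- (Hc (x O)); apply Hz.
- destruct (is_poly_factor _ (x (S n)) _ Pp) as [q [Pq Hq]].
  assert (E : forall s, p s = (RtoC s - RtoC (x (S n))) * q s).
  { intros s; rewrite <- Hq, (Hz (S n)) by lia; ring. }
  rewrite E, (IH q); [ring| |easy|].
  + intros i j Hij; apply Hx; lia.
  + intros j Hj.
    destruct (Ceq_dec (q (x j)) 0) as [?|Hn]; [easy|].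
    exfalso; apply (Cmult_neq_0 (RtoC (x j) - RtoC (x (S n))) (q (x j))).
    * apply RtoC_sub_neq0, Hx; lia.
    * easy.
    * rewrite <- E; apply Hz; lia.
Qed.

Lemma nodal_poly (n : nat) (x : nat -> R) :
  (forall i j, (i < j <= S n)%nat -> x i <> x j) ->
  exists w, is_poly (S n) w /\ (forall j, (j <= n)%nat -> w (x j) = 0)
            /\ forall j, (n < j <= S n)%nat -> w (x j) <> 0.
Proof.
intros Hx.
assert (H : forall m, exists w, is_poly (S m) w /\
  (forall j, (j <= m)%nat -> w (x j) = 0) /\
  forall t, (forall j, (j <= m)%nat -> t <> x j) -> w t <> 0).
{ induction m as [|m [w [Pw [Zw Nw]]]].
  - exists (fun t => (RtoC t - RtoC (x O)) * 1); repeat split.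
    + apply is_poly_mul with (p := fun _ => RtoC 1), is_poly_0; now exists 1.
    + intros j Hj; replace j with O by lia; ring.
    + intros t Ht; apply Cmult_neq_0.
      * now apply RtoC_sub_neq0, Ht.
      * intros E; apply RtoC_inj in E; lra.
  - exists (fun t => (RtoC t - RtoC (x (S m))) * w t); repeat split.
    + now apply is_poly_mul.
    + intros j Hj; destruct (Nat.eq_dec j (S m)) as [->|Hn]; [ring|].
      rewrite Zw by lia; ring.
    + intros t Ht; apply Cmult_neq_0.
      * now apply RtoC_sub_neq0, Ht.
      * apply Nw; intros j Hj; apply Ht; lia. }
destruct (H n) as [w [Pw [Zw Nw]]]; exists w; repeat split; try easy.
intros j Hj; apply Nw; intros i Hi E; apply (Hx i j); [lia|easy].
Qed.

Lemma interp_exists (n : nat) (x : nat -> R) (f : R -> C) :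
  (forall i j, (i < j <= n)%nat -> x i <> x j) ->
  exists q, is_poly n q /\ forall j, (j <= n)%nat -> q (x j) = f (x j).
Proof.
induction n as [|n IH]; intros Hx.
- exists (fun _ => f (x O)); split.
  + apply is_poly_0; now exists (f (x O)).
  + intros j Hj; now replace j with O by lia.
- destruct IH as [q [Pq Hq]]; [intros i j Hij; apply Hx; lia|].
  destruct (nodal_poly n x Hx) as [w [Pw [Zw Nw]]].
  assert (Nn := Nw (S n) ltac:(lia)).
  exists (fun t => q t + (f (x (S n)) - q (x (S n))) / w (x (S n)) * w t).
  split.
  + apply is_poly_lin; [now apply is_poly_up|easy].
  + intros j Hj; destruct (Nat.eq_dec j (S n)) as [->|Hn].
    * now field.
    * rewrite (Zw j), (Hq j) by lia; now field.
Qed.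

Lemma cheb_pt_inj (N i j : nat) :
  (i < j <= N)%nat -> cheb_pt N i <> cheb_pt N j.
Proof.
intros Hij E; unfold cheb_pt in E.
assert (HN : (0 < INR N)%R) by (apply lt_0_INR; lia).
assert (range : forall k, (k <= N)%nat -> (0 <= PI * INR k / INR N <= PI)%R).
{ intros k Hk; assert (HP := PI_RGT_0); apply le_INR in Hk.
  assert (H0 := pos_INR k); unfold Rdiv; rewrite Rmult_assoc; split.
  - apply Rmult_le_pos; [lra|].
    apply Rmult_le_pos; [easy|left; now apply Rinv_0_lt_compat].
  - rewrite <- (Rmult_1_r PI) at 2; apply Rmult_le_compat_l; [lra|].
    now apply (Rdiv_le_1 (INR k) (INR N)). }
apply cos_inj in E; try (apply range; lia).
assert (HP := PI_RGT_0).
assert (E' : INR i = INR j).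
{ apply (Rmult_eq_reg_l (PI / INR N)%R).
  - unfold Rdiv in *; lra.
  - apply Rgt_not_eq, Rdiv_lt_0_compat; lra. }
apply INR_eq in E'; lia.
Qed.

Lemma interp_exists_unique (N : nat) (f : R -> C) :
  exists! q : R -> C, is_interp N f q.
Proof.
destruct (interp_exists N (cheb_pt N) f (cheb_pt_inj N)) as [q [Pq Hq]].
exists q; split; [easy|intros r [Pr Hr]].
apply functional_extensionality; intros t.
assert (Z : q t + (- 1) * r t = 0).
{ apply (is_poly_zero N (cheb_pt N) (fun s => q s + (- 1) * r s)).
  - exact (cheb_pt_inj N).
  - now apply is_poly_lin.
  - intros j Hj; rewrite Hq, Hr by easy; ring. }
replace (q t) with (q t + (- 1) * r t + r t) by ring.
rewrite Z; ring.
Qed.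

Definition cheb_interp (N : nat) (f : R -> C) : R -> C :=
  proj1_sig (constructive_definite_description _ (interp_exists_unique N f)).

Lemma cheb_interpP (N : nat) (f : R -> C) : is_interp N f (cheb_interp N f).
Proof. exact (proj2_sig (constructive_definite_description _ _)). Qed.

(* Main.v *)
Require Import Defs.
From Stdlib Require Import Reals Lra Lia FunctionalExtensionality.
From Coquelicot Require Import Coquelicot.
Open Scope R_scope.

(** The error [e = y - p] satisfies [e(-1) = 0] and [e' = a e + g] with
    [g = a p + u - p'], so two facts are enough: [g] is bounded on [[-1,1]] by
    the sum in parentheses, and a forcing term of size [G] acting over an
    interval of length 2 produces an error of at most [2 * Ca * G].

    For the first, write [g = (a p - I_N(a p)) + (u - I_N u) - r] with
    [r = p' - I_N(a p) - I_N u].  The collocation conditions say that the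
    polynomial [r], of degree at most [N], vanishes at all nodes but the last,
    [-1], where its value is [Rp].  Hence [r = Rp * L], where [L] is the Lagrange
    cardinal polynomial of the node [-1].  Since the other nodes are [1] and the
    zeros of the Chebyshev polynomial [U_(N-1)], the polynomial [L] is a
    multiple of [(t - 1) U_(N-1)(t)].  The bound [|U_(N-1)| <= N], attained at
    [-1], together with [|t - 1| <= 2] then gives [|L| <= 1], whence [|r| <= |Rp|]
    ([endpoint_cardinal], [poly_defect_le_endpoint]).

    The second is a Gronwall estimate ([linear_ode_bound]).  Since
    [Re (conj e * e') <= m |e|^2 + G |e|] with [m = max(Re a, 0)], the modulus
    [|e|] formally satisfies [|e|' <= m |e| + G].  It need not be differentiable
    where [e] vanishes, so [gronwall] works with [sqrt(|e|^2 + eta^2)] and lets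
    [eta] tend to 0.

    Derivatives at the ends of the interval are one-sided.  They matter because
    the values of [p'] at [1] and [-1] enter the hypotheses: on the whole closed
    interval they determine the polynomial derivative ([is_poly_derive_on]). *)

(** * Continuity on the interval *)

(** Composing with the retraction of the line onto [[-1,1]] turns continuity on
    the interval into continuity at every real number, which is what the mean
    value theorem and the integral ask for. *)
Definition clamp (t : R) : R := Rmax (-1) (Rmin t 1).

Lemma clamp_in (t : R) : I11 (clamp t).
Proof.
unfold clamp, I11, Rmax, Rmin.
destruct (Rle_dec t 1); destruct (Rle_dec (-1) _); lra.
Qed.

Lemma clamp_id (t : R) : I11 t -> clamp t = t.
Proof.
unfold clamp, I11, Rmax, Rmin.
destruct (Rle_dec t 1); destruct (Rle_dec (-1) _); lra.
Qed.

Lemma clamp_lipschitz (s t : R) : Rabs (clamp s - clamp t) <= Rabs (s - t).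
Proof.
unfold clamp, Rmax, Rmin.
destruct (Rle_dec t 1); destruct (Rle_dec s 1);
  repeat destruct (Rle_dec (-1) _); unfold Rabs;
  repeat destruct (Rcase_abs _); lra.
Qed.

Definition clamped_continuous (f : R -> C) : Prop :=
  continuity (fun t => Re (f (clamp t))) /\
  continuity (fun t => Im (f (clamp t))).

Lemma clamp_filterlim (t : R) :
  filterlim clamp (locally t) (within I11 (locally (clamp t))).
Proof.
intros P [eps He]; exists eps; intros s Hs.
apply He; [|apply clamp_in].
eapply Rle_lt_trans; [apply clamp_lipschitz|exact Hs].
Qed.

Lemma continuous_on_clamped (f : R -> C) :
  continuous_on I11 f -> clamped_continuous f.
Proof.
intros Hf.
assert (H : forall t, filterlim (fun s => f (clamp s)) (locally t)
                        (locally (f (clamp t)))).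
{ intros t; eapply filterlim_comp; [apply clamp_filterlim|].
  apply Hf, clamp_in. }
split; intros t; apply continuity_pt_filterlim.
- refine (filterlim_comp _ _ _ _ fst _ _ _ (H t) _).
  destruct (f (clamp t)) as [x z]; apply (continuous_fst x z).
- refine (filterlim_comp _ _ _ _ snd _ _ _ (H t) _).
  destruct (f (clamp t)) as [x z]; apply (continuous_snd x z).
Qed.

Lemma clamped_continuous_plus (f g : R -> C) :
  clamped_continuous f -> clamped_continuous g ->
  clamped_continuous (fun t => f t + g t)%C.
Proof.
intros [f1 f2] [g1 g2]; split.
- exact (continuity_plus _ _ f1 g1).
- exact (continuity_plus _ _ f2 g2).
Qed.

Lemma clamped_continuous_minus (f g : R -> C) :
  clamped_continuous f -> clamped_continuous g ->
  clamped_continuous (fun t => f t - g t)%C.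
Proof.
intros [f1 f2] [g1 g2]; split.
- exact (continuity_minus _ _ f1 g1).
- exact (continuity_minus _ _ f2 g2).
Qed.

Lemma clamped_continuous_mult (f g : R -> C) :
  clamped_continuous f -> clamped_continuous g ->
  clamped_continuous (fun t => f t * g t)%C.
Proof.
intros [f1 f2] [g1 g2]; split.
- exact (continuity_minus _ _ (continuity_mult _ _ f1 g1)
           (continuity_mult _ _ f2 g2)).
- exact (continuity_plus _ _ (continuity_mult _ _ f1 g2)
           (continuity_mult _ _ f2 g1)).
Qed.

Lemma is_poly_clamped_continuous (n : nat) (p : R -> C) :
  is_poly n p -> clamped_continuous p.
Proof.
revert p; induction n as [|n IH]; intros p Hp.
- apply is_poly_0 in Hp as [c Hc].
  replace p with (fun _ : R => c)
    by (apply functional_extensionality; intros; now rewrite Hc).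
  split; intros t; apply continuity_pt_const; now intros ? ?.
- apply is_poly_S in Hp as [c [q [Hq Hp]]].
  replace p with (fun t => c + RtoC t * q t)%C
    by (apply functional_extensionality; intros; now rewrite Hp).
  apply clamped_continuous_plus, clamped_continuous_mult.
  + split; intros t; apply continuity_pt_const; now intros ? ?.
  + split; intros t; [|apply continuity_pt_const; now intros ? ?].
    apply continuity_pt_filterlim.
    intros P HP; apply (clamp_filterlim t); now apply filter_le_within.
  + now apply IH.
Qed.

(** [norm_sup] is the real part of an extended supremum, hence 0 when that
    supremum is infinite; continuity on a compact interval excludes this case. *)
Lemma Cmod_le_norm_sup (f : R -> C) (t : R) :
  clamped_continuous f -> I11 t -> Cmod (f t) <= norm_sup f.
Proof.
intros [f1 f2] Ht.
pose (x := fun s => Re (f (clamp s))); pose (z := fun s => Im (f (clamp s))).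
assert (Hc : continuity (fun s => (x s * x s + z s * z s))).
{ exact (continuity_plus _ _ (continuity_mult _ _ f1 f1)
           (continuity_mult _ _ f2 f2)). }
destruct (continuity_ab_maj _ (-1) 1 ltac:(lra) (fun c _ => Hc c))
  as [m [Hm Hm1]].
assert (HE : forall s, I11 s -> Cmod (f s) = sqrt (x s * x s + z s * z s)).
{ intros s Hs; unfold x, z, Cmod; rewrite clamp_id by easy; f_equal.
  unfold Re, Im; ring. }
unfold norm_sup.
set (E := fun r => exists t, I11 t /\ r = Cmod (f t)).
destruct (Lub_Rbar_correct E) as [Hub Hlub].
assert (Hfin := Hlub (Finite (Cmod (f m)))).
assert (Ht' := Hub (Cmod (f t)) (ex_intro _ t (conj Ht eq_refl))).
destruct (Lub_Rbar E) as [l| |]; simpl in *; try easy.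
exfalso; apply Hfin.
intros r [s [Hs ->]]; simpl.
rewrite (HE s Hs), (HE m Hm1); apply sqrt_le_1_alt, Hm, Hs.
Qed.

Lemma norm_sup_le (f : R -> C) (B : R) :
  (forall t, I11 t -> Cmod (f t) <= B) -> norm_sup f <= B.
Proof.
intros HB; unfold norm_sup.
set (E := fun r => exists t, I11 t /\ r = Cmod (f t)).
destruct (Lub_Rbar_correct E) as [Hub Hlub].
assert (H0 : I11 0) by (unfold I11; lra).
assert (Ht' := Hub (Cmod (f 0)) (ex_intro _ 0 (conj H0 eq_refl))).
assert (Hle := Hlub (Finite B)).
destruct (Lub_Rbar E) as [l| |]; simpl in *.
- apply Hle; intros r [s [Hs ->]]; simpl; auto.
- exfalso; apply Hle; intros r [s [Hs ->]]; simpl; auto.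
- easy.
Qed.

(** * One-sided derivatives and polynomials *)

(** The real components of [is_derive_on], in epsilon-delta form, where
    uniqueness at an endpoint is elementary. *)
Definition is_derive_I (f : R -> R) (t l : R) : Prop :=
  forall eps : posreal, exists d : posreal, forall s, I11 s ->
    Rabs (s - t) < d ->
    Rabs (f s - f t - (s - t) * l) <= eps * Rabs (s - t).

Lemma is_derive_on_components (f : R -> C) (t : R) (l : C) :
  I11 t -> is_derive_on I11 f t l ->
  is_derive_I (fun s => Re (f s)) t (Re l) /\
  is_derive_I (fun s => Im (f s)) t (Im l).
Proof.
intros Ht [_ H].
assert (Hl : is_filter_lim (within I11 (locally t)) t).
{ intros P HP; now apply filter_le_within. }
assert (B : forall w : C, Rabs (Re w) <= norm (w : C_R_NormedModule) /\
                   Rabs (Im w) <= norm (w : C_R_NormedModule)).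
{ intros w.
  assert (Hw : norm (w : C_R_NormedModule) = Cmod w).
  { unfold norm; simpl; unfold prod_norm, norm; simpl.
    unfold abs; simpl; unfold Cmod; f_equal.
    rewrite !Rmult_1_r, <- !Rabs_mult, !Rabs_pos_eq; nra. }
  rewrite Hw; generalize (Rmax_Cmod w); intros Hm; unfold Re, Im; split.
  - eapply Rle_trans; [apply Rmax_l|exact Hm].
  - eapply Rle_trans; [apply Rmax_r|exact Hm]. }
split; intros eps; destruct (H t Hl eps) as [d Hd]; exists d;
  intros s Hs Hst; specialize (Hd s Hst Hs);
  (eapply Rle_trans; [|exact Hd]).
- exact (proj1 (B (minus (minus (f s) (f t)) (scal (minus s t) l)))).
- exact (proj2 (B (minus (minus (f s) (f t)) (scal (minus s t) l)))).
Qed.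

Lemma is_derive_I_interior (f : R -> R) (t l : R) :
  -1 < t < 1 -> is_derive_I f t l -> is_derive f t l.
Proof.
intros Ht H; apply is_derive_Reals; intros eps He.
assert (He2 : 0 < eps / 2) by lra.
destruct (H (mkposreal _ He2)) as [d Hd]; simpl in Hd.
assert (Hm : 0 < Rmin d (Rmin (1 - t) (t + 1))).
{ destruct d; simpl; repeat apply Rmin_pos; lra. }
exists (mkposreal _ Hm); intros h Hh Hhd; simpl in Hhd.
assert (H1 := Rmin_l d (Rmin (1 - t) (t + 1))).
assert (H2 := Rmin_r d (Rmin (1 - t) (t + 1))).
assert (H3 := Rmin_l (1 - t) (t + 1)).
assert (H4 := Rmin_r (1 - t) (t + 1)).
assert (Hh' : - Rabs h <= h <= Rabs h).
{ unfold Rabs; destruct (Rcase_abs h); lra. }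
assert (Hp : 0 < Rabs h) by now apply Rabs_pos_lt.
specialize (Hd (t + h)); replace (t + h - t) with h in Hd by ring.
replace ((f (t + h) - f t) / h - l) with ((f (t + h) - f t - h * l) / h)
  by (field; easy).
rewrite Rabs_div by easy.
apply (Rmult_lt_reg_r (Rabs h)); [easy|].
unfold Rdiv; rewrite Rmult_assoc, Rinv_l, Rmult_1_r by lra.
eapply Rle_lt_trans; [apply Hd|]; [unfold I11; lra|lra|nra].
Qed.

Lemma is_derive_is_derive_I (f : R -> R) (t l : R) :
  is_derive f t l -> is_derive_I f t l.
Proof.
intros [_ H] eps.
destruct (H t (fun P HP => HP) eps) as [d Hd].
exists d; intros s _ Hs; apply (Hd s Hs).
Qed.

(** Every point of [[-1,1]], endpoints included, has points of the interval
    arbitrarily close to it on at least one side: on the right if [t <= 0], on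
    the left if [t > 0]. *)
Lemma is_derive_I_unique (f : R -> R) (t l m : R) :
  I11 t -> is_derive_I f t l -> is_derive_I f t m -> l = m.
Proof.
intros Ht Hl Hm.
apply cond_eq; intros eps He.
assert (He4 : 0 < eps / 4) by lra.
destruct (Hl (mkposreal _ He4)) as [d Hd]; simpl in Hd.
destruct (Hm (mkposreal _ He4)) as [d' Hd']; simpl in Hd'.
assert (Hs : exists s, I11 s /\ 0 < Rabs (s - t) /\
               Rabs (s - t) < d /\ Rabs (s - t) < d').
{ assert (Hr : 0 < Rmin 1 (Rmin d d')).
  { destruct d, d'; simpl; repeat apply Rmin_pos; lra. }
  assert (H1 := Rmin_l 1 (Rmin d d')).
  assert (H2 := Rmin_r 1 (Rmin d d')).
  assert (H3 := Rmin_l d d'); assert (H4 := Rmin_r d d').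
  set (r := Rmin 1 (Rmin d d')) in *.
  unfold I11 in *.
  destruct (Rle_dec t 0).
  - exists (t + r / 2); replace (t + r / 2 - t) with (r / 2) by ring.
    rewrite Rabs_pos_eq; lra.
  - exists (t - r / 2); replace (t - r / 2 - t) with (- (r / 2)) by ring.
    rewrite Rabs_Ropp, Rabs_pos_eq; lra. }
destruct Hs as [s [Hs [Hp [H1 H2]]]].
specialize (Hd s Hs H1); specialize (Hd' s Hs H2).
apply (Rmult_lt_reg_r (Rabs (s - t))); [easy|].
rewrite <- Rabs_mult.
replace ((l - m) * (s - t)) with
  ((f s - f t - (s - t) * m) - (f s - f t - (s - t) * l)) by ring.
eapply Rle_lt_trans; [apply Rabs_triang|rewrite Rabs_Ropp; nra].
Qed.

Lemma is_derive_affine_mult (c t l : R) (f : R -> R) :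
  is_derive f t l -> is_derive (fun s => c + s * f s) t (f t + t * l).
Proof.
intros H; assert (E : Derive (fun s : R => f s) t = l)
  by now apply is_derive_unique.
auto_derive; [now exists l|rewrite E; ring].
Qed.

Lemma is_poly_derive (n : nat) (p : R -> C) :
  is_poly n p ->
  exists q, is_poly n q /\ forall t,
    is_derive (fun s => Re (p s)) t (Re (q t)) /\
    is_derive (fun s => Im (p s)) t (Im (q t)).
Proof.
revert p; induction n as [|n IH]; intros p Hp.
- apply is_poly_0 in Hp as [c Hc].
  exists (fun _ => 0%C); split; [apply is_poly_0; now exists 0%C|].
  intros t; split.
  + apply (is_derive_ext (fun _ => Re c)); [intros; now rewrite Hc|].
    apply (is_derive_const (Re c)).
  + apply (is_derive_ext (fun _ => Im c)); [intros; now rewrite Hc|].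
    apply (is_derive_const (Im c)).
- apply is_poly_S in Hp as [c [r [Hr Hp]]].
  destruct (IH r Hr) as [r' [Hr' Hd]].
  exists (fun t => r t + 1 * (RtoC t * r' t))%C; split.
  + apply is_poly_lin; [now apply is_poly_up|].
    apply is_poly_S; exists 0%C, r'; split; [easy|intros t; ring].
  + intros t; destruct (Hd t) as [D1 D2]; split.
    * apply (is_derive_ext (fun s => Re c + s * Re (r s))).
      { intros s; rewrite Hp; unfold Re, Im; simpl; ring. }
      replace (Re (r t + 1 * (RtoC t * r' t))) with (Re (r t) + t * Re (r' t))
        by (unfold Re, Im; simpl; ring).
      now apply is_derive_affine_mult.
    * apply (is_derive_ext (fun s => Im c + s * Im (r s))).
      { intros s; rewrite Hp; unfold Re, Im; simpl; ring. }
      replace (Im (r t + 1 * (RtoC t * r' t))) with (Im (r t) + t * Im (r' t))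
        by (unfold Re, Im; simpl; ring).
      now apply is_derive_affine_mult.
Qed.

Lemma is_poly_derive_on (n : nat) (p dp : R -> C) :
  is_poly n p ->
  (forall t, I11 t -> is_derive_on I11 p t (dp t)) ->
  exists q, is_poly n q /\ forall t, I11 t -> dp t = q t.
Proof.
intros Hp Hd; destruct (is_poly_derive n p Hp) as [q [Hq Hdq]].
exists q; split; [easy|intros t Ht].
destruct (is_derive_on_components _ _ _ Ht (Hd t Ht)) as [D1 D2].
destruct (Hdq t) as [E1 E2].
apply is_derive_is_derive_I in E1; apply is_derive_is_derive_I in E2.
assert (F1 := is_derive_I_unique _ _ _ _ Ht D1 E1).
assert (F2 := is_derive_I_unique _ _ _ _ Ht D2 E2).
now apply injective_projections.
Qed.

(** * The cardinal polynomial of the node -1 *)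

(** Chebyshev polynomials of the second kind. *)
Fixpoint cheb_U (k : nat) (t : R) : R :=
  match k with
  | O => 1
  | S k' => match k' with
            | O => 2 * t
            | S k'' => 2 * t * cheb_U k' t - cheb_U k'' t
            end
  end.

Lemma cheb_U_SS (k : nat) (t : R) :
  cheb_U (S (S k)) t = 2 * t * cheb_U (S k) t - cheb_U k t.
Proof. reflexivity. Qed.

Lemma nat_ind2 (P : nat -> Prop) :
  P O -> P 1%nat -> (forall k, P k -> P (S k) -> P (S (S k))) ->
  forall k, P k.
Proof.
intros H0 H1 HS k; enough (P k /\ P (S k)) by easy.
induction k as [|k [IH1 IH2]]; auto.
Qed.

Lemma is_poly_scal (n : nat) (c : C) (p : R -> C) :
  is_poly n p -> is_poly n (fun t => c * p t)%C.
Proof.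
intros H; replace (fun t => c * p t)%C with (fun t => p t + (c - 1) * p t)%C
  by (apply functional_extensionality; intros; ring).
now apply is_poly_lin.
Qed.

Lemma is_poly_cheb_U (k : nat) : is_poly k (fun t => RtoC (cheb_U k t)).
Proof.
induction k as [| |k IH1 IH2] using nat_ind2.
- apply is_poly_0; now exists (RtoC 1).
- apply is_poly_S; exists 0%C, (fun _ => RtoC 2); split.
  + apply is_poly_0; now exists (RtoC 2).
  + intros t; unfold cheb_U; rewrite RtoC_mult; ring.
- replace (fun t => RtoC (cheb_U (S (S k)) t)) with
    (fun t => RtoC t * (RtoC 2 * RtoC (cheb_U (S k) t))
              + - RtoC 1 * RtoC (cheb_U k t))%C.
  + apply is_poly_lin; [|now do 2 apply is_poly_up].
    apply is_poly_S.
    exists 0%C, (fun t => RtoC 2 * RtoC (cheb_U (S k) t))%C; split.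
    * now apply is_poly_scal.
    * intros t; ring.
  + apply functional_extensionality; intros t; rewrite cheb_U_SS.
    rewrite RtoC_minus, !RtoC_mult; ring.
Qed.

Lemma cheb_U_cos (k : nat) (x : R) :
  sin x * cheb_U k (cos x) = sin (INR (S k) * x).
Proof.
induction k as [| |k IH1 IH2] using nat_ind2.
- simpl; rewrite Rmult_1_l; ring.
- simpl; replace ((1 + 1) * x) with (2 * x) by ring; rewrite sin_2a; ring.
- rewrite cheb_U_SS.
  replace (sin x * (2 * cos x * cheb_U (S k) (cos x) - cheb_U k (cos x)))
    with (2 * cos x * (sin x * cheb_U (S k) (cos x)) - sin x * cheb_U k (cos x))
    by ring.
  rewrite IH1, IH2.
  replace (INR (S k) * x) with (INR (S (S k)) * x - x)
    by (rewrite (S_INR (S k)); ring).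
  replace (INR (S (S (S k))) * x) with (INR (S (S k)) * x + x)
    by (rewrite (S_INR (S (S k))); ring).
  rewrite sin_plus, sin_minus; ring.
Qed.

Lemma cheb_U_m1 (k : nat) : cheb_U k (-1) = (-1) ^ k * INR (S k).
Proof.
induction k as [| |k IH1 IH2] using nat_ind2.
- simpl; ring.
- simpl; ring.
- rewrite cheb_U_SS, IH1, IH2, !S_INR; simpl; ring.
Qed.

Lemma Rabs_sin_mult (n : nat) (x : R) :
  Rabs (sin (INR n * x)) <= INR n * Rabs (sin x).
Proof.
induction n as [|n IH].
- simpl; rewrite !Rmult_0_l, sin_0, Rabs_R0; lra.
- rewrite S_INR, Rmult_plus_distr_r, Rmult_1_l, sin_plus.
  eapply Rle_trans; [apply Rabs_triang|]; rewrite !Rabs_mult.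
  assert (H1 : Rabs (cos x) <= 1) by (apply Rabs_le, COS_bound).
  assert (H2 : Rabs (cos (INR n * x)) <= 1) by (apply Rabs_le, COS_bound).
  assert (H3 := Rabs_pos (sin x)).
  assert (H4 := Rabs_pos (sin (INR n * x))).
  nra.
Qed.

Lemma cheb_U_bound (k : nat) (t : R) :
  -1 < t < 1 -> Rabs (cheb_U k t) <= INR (S k).
Proof.
intros Ht.
assert (Hs : 0 < sin (acos t)).
{ rewrite sin_acos by lra; apply sqrt_lt_R0; unfold Rsqr; nra. }
assert (H := Rabs_sin_mult (S k) (acos t)).
rewrite <- cheb_U_cos, cos_acos, Rabs_mult in H by lra.
rewrite (Rabs_pos_eq (sin _)) in H by lra.
nra.
Qed.

Lemma cheb_U_node (k j : nat) :
  (0 < j < S k)%nat -> cheb_U k (cheb_pt (S k) j) = 0.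
Proof.
intros Hj; unfold cheb_pt.
set (x := PI * INR j / INR (S k)).
assert (HN : 0 < INR (S k)) by (apply lt_0_INR; lia).
assert (HP := PI_RGT_0).
assert (Hj0 : 0 < INR j) by (apply lt_0_INR; lia).
assert (Hj1 : INR j < INR (S k)) by (apply lt_INR; lia).
assert (E : INR (S k) * x = INR j * PI) by (unfold x; field; lra).
assert (Hx : 0 < x < PI) by (split; nra).
assert (Hs := sin_gt_0 x (proj1 Hx) (proj2 Hx)).
assert (H := cheb_U_cos k x).
rewrite E, (sin_eq_0_1 (INR j * PI)) in H.
- apply Rmult_integral in H; lra.
- exists (Z.of_nat j); now rewrite INR_IZR_INZ.
Qed.

(** The witness is [(t - 1) U_(N-1)(t)], normalised at [-1].  There the factors
    [t - 1] and [U_(N-1)] both reach their largest absolute values, 2 and [N], so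
    that after normalisation the maximum over the interval is 1. *)
Lemma endpoint_cardinal (N : nat) :
  (1 <= N)%nat ->
  exists L : R -> C, is_poly N L /\
    (forall j, (j < N)%nat -> L (cheb_pt N j) = 0%C) /\
    L (-1) = 1%C /\
    forall t, I11 t -> Cmod (L t) <= 1.
Proof.
intros HN; destruct N as [|k]; [lia|]; clear HN.
assert (HN : 0 < INR (S k)) by (apply lt_0_INR; lia).
(* The inverse of [(-1 - 1) * cheb_U k (-1)], by [cheb_U_m1]. *)
pose (w := - (-1) ^ k / (2 * INR (S k))).
pose (f := fun t => w * ((t - 1) * cheb_U k t)).
exists (fun t => RtoC (f t)).
assert (Hw1 : w * (-2 * ((-1) ^ k * INR (S k))) = 1).
{ transitivity ((-1) ^ k * (-1) ^ k); [unfold w; field; lra|].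
  rewrite <- Rpow_mult_distr; replace (-1 * -1) with 1 by ring; apply pow1. }
assert (Hw2 : Rabs w = / (2 * INR (S k))).
{ unfold w; rewrite Rabs_div by lra; rewrite Rabs_Ropp, pow_1_abs.
  rewrite Rabs_pos_eq by lra; unfold Rdiv; ring. }
repeat split.
- replace (fun t => RtoC (f t)) with
    (fun t => RtoC w * ((RtoC t - RtoC 1) * RtoC (cheb_U k t)))%C.
  + apply is_poly_scal, is_poly_mul, is_poly_cheb_U.
  + apply functional_extensionality; intros t; unfold f.
    rewrite !RtoC_mult, !RtoC_minus; ring.
- intros j Hj; apply f_equal; unfold f.
  destruct j as [|j].
  + replace (cheb_pt (S k) 0) with 1; [ring|].
    unfold cheb_pt; simpl INR at 1.
    unfold Rdiv; now rewrite Rmult_0_r, Rmult_0_l, cos_0.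
  + rewrite cheb_U_node by lia; ring.
- apply f_equal; rewrite <- Hw1; unfold f; rewrite cheb_U_m1; ring.
- intros t Ht; rewrite Cmod_R.
  (* [cheb_U_bound] divides by [sin (acos t)], so both ends are separate. *)
  destruct (Req_dec t 1) as [->|H1].
  { unfold f; replace (w * _) with 0 by ring; rewrite Rabs_R0; lra. }
  destruct (Req_dec t (-1)) as [->|H2].
  { replace (f (-1)) with 1; [rewrite Rabs_R1; lra|].
    rewrite <- Hw1; unfold f; rewrite cheb_U_m1; ring. }
  unfold I11 in Ht.
  assert (HU := cheb_U_bound k t ltac:(lra)).
  unfold f; rewrite !Rabs_mult, Hw2.
  apply (Rmult_le_reg_l (2 * INR (S k))); [lra|].
  rewrite <- Rmult_assoc, Rinv_r, Rmult_1_l, Rmult_1_r by lra.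
  rewrite Rabs_left by lra.
  apply Rmult_le_compat; try lra; apply Rabs_pos.
Qed.

Lemma cheb_pt_last (N : nat) : (1 <= N)%nat -> cheb_pt N N = -1.
Proof.
intros HN; unfold cheb_pt.
assert (0 < INR N) by (apply lt_0_INR; lia).
replace (PI * INR N / INR N) with PI by (field; lra); apply cos_PI.
Qed.

Lemma cheb_pt_I11 (N j : nat) : I11 (cheb_pt N j).
Proof. apply COS_bound. Qed.

(** A polynomial of degree at most [N] that vanishes at the first [N] nodes is
    its value at [-1] times the cardinal polynomial of that node. *)
Lemma poly_defect_le_endpoint (N : nat) (q w : R -> C) :
  (1 <= N)%nat -> is_poly N q -> is_poly N w ->
  (forall j, (j < N)%nat -> q (cheb_pt N j) = w (cheb_pt N j)) ->
  forall t, I11 t -> Cmod (q t - w t)%C <= Cmod (q (-1) - w (-1))%C.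
Proof.
intros HN Hq Hw Hn t Ht.
destruct (endpoint_cardinal N HN) as [L [HL [HL0 [HL1 HLb]]]].
set (c := (q (-1) - w (-1))%C).
assert (Z : forall s, (q s + - (1) * w s + - c * L s = 0)%C).
{ apply (is_poly_zero N (cheb_pt N)
    (fun s => q s + - (1) * w s + - c * L s)%C (cheb_pt_inj N)).
  - now repeat apply is_poly_lin.
  - intros j Hj; destruct (Nat.eq_dec j N) as [->|Hne].
    + rewrite cheb_pt_last, HL1 by easy; unfold c; ring.
    + rewrite HL0, Hn by lia; ring. }
replace (q t - w t)%C with (c * L t)%C.
- rewrite Cmod_mult; apply (Rle_trans _ (Cmod c * 1)); [|lra].
  apply Rmult_le_compat_l; [apply Cmod_ge_0|now apply HLb].
- replace (q t - w t)%C with (q t + - (1) * w t + - c * L t + c * L t)%C by ring.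
  rewrite Z; ring.
Qed.

(** * A Gronwall estimate *)

Lemma nonincreasing_of_derive (f df : R -> R) (a b : R) :
  a <= b -> continuity f ->
  (forall t, a < t < b -> is_derive f t (df t) /\ df t <= 0) ->
  f b <= f a.
Proof.
intros Hab Hc Hd.
destruct (Req_dec a b) as [->|Hn]; [lra|].
assert (Hab' : a < b) by lra.
assert (pr1 : forall t, a < t < b -> derivable_pt f t).
{ intros t Ht; exists (df t); apply is_derive_Reals, Hd, Ht. }
destruct (MVT f id a b pr1 (fun c _ => derivable_pt_id c) Hab'
           (fun c _ => Hc c)
           (fun c _ => derivable_continuous_pt _ _ (derivable_pt_id c)))
  as [c [Hc' E]].
rewrite derive_pt_id in E; unfold id in E.
destruct (Hd c Hc') as [D1 D2].
rewrite (proj2 (derive_pt_eq f c (df c) (pr1 c Hc'))) in E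
  by now apply is_derive_Reals.
nra.
Qed.

Lemma exp_le_compat (r s : R) : r <= s -> exp r <= exp s.
Proof.
intros [H| ->]; [left; now apply exp_increasing|right; reflexivity].
Qed.

(** With [x] and [z] the real and imaginary parts of [e], the differential
    inequality bounds the derivative of [|e|^2 / 2]; in this form it is
    meaningful also where [e] vanishes.  Off the zeros, division by [|e|] gives
    [|e|' <= m |e| + G], so with [M] the primitive of [m] that vanishes at [-1],
    [|e| exp(-M)] grows at a rate of at most [G]. *)
Lemma gronwall (m x z dx dz : R -> R) (G : R) :
  continuity m -> (forall t, 0 <= m t) ->
  continuity x -> continuity z ->
  (forall t, -1 < t < 1 -> is_derive x t (dx t)) ->
  (forall t, -1 < t < 1 -> is_derive z t (dz t)) ->
  0 <= G ->
  (forall t, -1 < t < 1 ->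
     x t * dx t + z t * dz t
     <= m t * (x t ^ 2 + z t ^ 2) + G * sqrt (x t ^ 2 + z t ^ 2)) ->
  x (-1) = 0 -> z (-1) = 0 ->
  forall t, I11 t ->
    sqrt (x t ^ 2 + z t ^ 2) <= 2 * exp (RInt m (-1) 1) * G.
Proof.
intros Hm Hm0 Hx Hz Hdx Hdz HG Hode Hx0 Hz0 t Ht; unfold I11 in Ht.
pose (M := fun s => RInt m (-1) s).
assert (Hmc : forall s, continuous m s).
{ intros s; apply continuity_pt_filterlim, Hm. }
assert (HdM : forall s, is_derive M s (m s)).
{ intros s; apply (is_derive_RInt m M (-1)); [|apply Hmc].
  apply filter_forall; intros s'; apply (@RInt_correct R_CompleteNormedModule).
  apply (@ex_RInt_continuous R_CompleteNormedModule); intros; apply Hmc. }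
assert (HM : continuity M).
{ intros s; apply derivable_continuous_pt.
  exists (m s); apply is_derive_Reals, HdM. }
assert (HMm1 : M (-1) = 0) by apply (@RInt_point R_CompleteNormedModule).
assert (Hmono : forall s s', s <= s' -> M s <= M s').
{ intros s s' Hs; apply Ropp_le_cancel.
  apply (nonincreasing_of_derive (fun r => - M r) (fun r => - m r) s s' Hs).
  - exact (continuity_opp _ HM).
  - intros r _; split; [apply (is_derive_opp M), HdM|].
    specialize (Hm0 r); lra. }
assert (Hmain : forall eta, 0 < eta ->
  sqrt (x t ^ 2 + z t ^ 2) <= exp (M 1) * (eta + 2 * G)).
{ intros eta He.
  pose (q := fun s => x s ^ 2 + z s ^ 2 + eta ^ 2).
  assert (Hq : forall s, 0 < q s) by (intros s; unfold q; nra).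
  (* The shift by [eta ^ 2] makes this smoothed modulus differentiable at zeros. *)
  pose (phi := fun s => sqrt (q s)).
  assert (Hphi : forall s, 0 < phi s /\ phi s * phi s = q s).
  { intros s; split; [apply sqrt_lt_R0, Hq|apply sqrt_sqrt; left; apply Hq]. }
  pose (F := fun s => phi s * exp (- M s) - G * s).
  pose (dF := fun s => (x s * dx s + z s * dz s) / phi s * exp (- M s)
                       - phi s * (exp (- M s) * m s) - G).
  assert (Hcq : continuity q).
  { unfold q; repeat apply continuity_plus.
    - intros s; apply (continuity_pt_comp x (fun r => r ^ 2)); [apply Hx|].
      apply derivable_continuous_pt, derivable_pt_pow.
    - intros s; apply (continuity_pt_comp z (fun r => r ^ 2)); [apply Hz|].
      apply derivable_continuous_pt, derivable_pt_pow.
    - apply continuity_const; now intros ? ?. }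
  assert (HF : F t <= F (-1)).
  { apply (nonincreasing_of_derive F dF); [lra| |].
    - unfold F; apply continuity_minus; [apply continuity_mult|].
      + intros s; apply (continuity_pt_comp q sqrt); [apply Hcq|].
        apply continuity_pt_sqrt; left; apply Hq.
      + intros s; apply (continuity_pt_comp (fun s => - M s) exp).
        * apply continuity_pt_opp, HM.
        * apply derivable_continuous_pt, derivable_pt_exp.
      + intros s; apply derivable_continuous_pt; reg.
    - intros s Hs; assert (Hs' : -1 < s < 1) by lra; split.
      + assert (D1 := Hdx s Hs'); assert (D2 := Hdz s Hs').
        assert (D3 := HdM s).
        assert (E1 : Derive (fun r : R => x r) s = dx s)
          by now apply is_derive_unique.
        assert (E2 : Derive (fun r : R => z r) s = dz s)
          by now apply is_derive_unique.
        assert (E3 : Derive (fun r : R => M r) s = m s)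
          by now apply is_derive_unique.
        specialize (Hq s); destruct (Hphi s) as [P _]; unfold phi in P.
        unfold F, phi, dF, q in *; auto_derive.
        * repeat split; try (eexists; eassumption); lra.
        * rewrite E1, E2, E3; unfold phi, q; simpl in *; field; lra.
      + destruct (Hphi s) as [P1 P2].
        set (r := x s ^ 2 + z s ^ 2).
        assert (Hr : 0 <= r) by (unfold r; nra).
        assert (S1 : sqrt r <= phi s)
          by (apply sqrt_le_1_alt; unfold q, r; nra).
        assert (S2 : r <= phi s * phi s) by (rewrite P2; unfold q, r; nra).
        assert (K : (x s * dx s + z s * dz s) / phi s <= m s * phi s + G).
        { apply (Rmult_le_reg_r (phi s)); [easy|].
          unfold Rdiv; rewrite Rmult_assoc, Rinv_l, Rmult_1_r by lra.
          eapply Rle_trans; [apply Hode, Hs'|]; fold r.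
          specialize (Hm0 s); nra. }
        assert (X1 : exp (- M s) <= 1).
        { rewrite <- exp_0; apply exp_le_compat.
          assert (H := Hmono (-1) s ltac:(lra)); lra. }
        assert (X0 := exp_pos (- M s)).
        unfold dF; nra. }
  assert (HFm1 : F (-1) = eta + G).
  { unfold F, phi, q; rewrite Hx0, Hz0, HMm1, Ropp_0, exp_0.
    replace (0 ^ 2 + 0 ^ 2 + eta ^ 2) with (eta * eta) by ring.
    rewrite sqrt_square by lra; ring. }
  assert (Hle : phi t <= exp (M t) * (eta + G * (t + 1))).
  { rewrite HFm1 in HF; unfold F in HF.
    replace (phi t) with (exp (M t) * (phi t * exp (- M t))).
    - apply Rmult_le_compat_l; [left; apply exp_pos|lra].
    - rewrite exp_Ropp; field; apply Rgt_not_eq, exp_pos. }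
  apply (Rle_trans _ (phi t)).
  { apply sqrt_le_1_alt; unfold q; nra. }
  eapply Rle_trans; [exact Hle|].
  apply Rmult_le_compat; [left; apply exp_pos|nra| |nra].
  apply exp_le_compat, Hmono; lra. }
change (RInt m (-1) 1) with (M 1).
assert (HC := exp_pos (M 1)).
apply le_epsilon; intros eps He.
(* The shift is scaled so that the excess [exp (M 1) * eta] is [eps]. *)
assert (H := Hmain (eps / exp (M 1)) ltac:(now apply Rdiv_lt_0_compat)).
replace (exp (M 1) * (eps / exp (M 1) + 2 * G))
  with (2 * exp (M 1) * G + eps) in H by (field; lra).
exact H.
Qed.

Lemma is_derive_clamp (h : C -> R) (f : R -> C) (t l : R) :
  -1 < t < 1 -> is_derive (fun s => h (f s)) t l ->
  is_derive (fun s => h (f (clamp s))) t l.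
Proof.
intros Ht; apply is_derive_ext_loc.
assert (H : locally t (fun s => -1 < s < 1)).
{ apply (open_and (fun s => -1 < s) (fun s => s < 1));
    [apply open_gt|apply open_lt|exact Ht]. }
revert H; apply filter_imp; intros s Hs.
rewrite clamp_id; [easy|unfold I11; lra].
Qed.

(** If [d = a e + g], then [Re (conj e * d) = Re a |e|^2 + Re (conj e * g)]: the
    imaginary part of [a] only rotates [e]. *)
Lemma Re_conj_mult_le (a e d : C) (G : R) :
  Cmod (d - a * e)%C <= G ->
  Re e * Re d + Im e * Im d <= Rmax (Re a) 0 * Cmod e ^ 2 + G * Cmod e.
Proof.
intros HG.
set (g := (d - a * e)%C) in HG.
assert (E : Re e * Re d + Im e * Im d
            = Re a * (Re e ^ 2 + Im e ^ 2) + Re (Cconj e * g)%C).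
{ unfold g, Re, Im; simpl; ring. }
assert (Q : Cmod e ^ 2 = Re e ^ 2 + Im e ^ 2).
{ unfold Cmod, Re, Im; rewrite pow2_sqrt; [easy|nra]. }
rewrite E, Q.
assert (K : Re (Cconj e * g)%C <= G * Cmod e).
{ eapply Rle_trans; [apply Rle_abs|].
  eapply Rle_trans; [apply re_le_Cmod|].
  rewrite Cmod_mult, Cmod_conj, Rmult_comm.
  apply Rmult_le_compat_r; [apply Cmod_ge_0|exact HG]. }
assert (H := Rmax_l (Re a) 0).
assert (0 <= Re e ^ 2 + Im e ^ 2) by nra.
nra.
Qed.

Lemma linear_ode_bound (a e de : R -> C) (G : R) :
  clamped_continuous a -> clamped_continuous e ->
  (forall t, -1 < t < 1 ->
     is_derive (fun s => Re (e s)) t (Re (de t)) /\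
     is_derive (fun s => Im (e s)) t (Im (de t))) ->
  (forall t, -1 < t < 1 -> Cmod (de t - a t * e t)%C <= G) ->
  e (-1) = 0%C ->
  forall t, I11 t ->
    Cmod (e t) <= 2 * exp (RInt (fun s => Rmax (Re (a s)) 0) (-1) 1) * G.
Proof.
intros [Ha _] [He1 He2] Hd HG He0 t Ht.
assert (HG0 : 0 <= G).
{ eapply Rle_trans; [apply Cmod_ge_0|apply (HG 0); lra]. }
pose (m := fun s => Rmax (Re (a (clamp s))) 0).
rewrite (RInt_ext _ m).
2:{ intros s; rewrite Rmin_left, Rmax_right by lra; intros Hs.
    unfold m; rewrite clamp_id; [easy|unfold I11; lra]. }
assert (HC : forall s, Cmod (e s) = sqrt (Re (e s) ^ 2 + Im (e s) ^ 2)) by easy.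
assert (H := gronwall m (fun s => Re (e (clamp s))) (fun s => Im (e (clamp s)))
          (fun s => Re (de s)) (fun s => Im (de s)) G).
specialize (fun h1 h2 h3 h4 h5 h6 h7 h8 h9 h10 =>
  H h1 h2 h3 h4 h5 h6 h7 h8 h9 h10 t Ht).
cbv beta in H; rewrite (clamp_id t Ht), <- HC in H; apply H; clear H; auto.
- replace m with (fun s => (Re (a (clamp s)) + Rabs (Re (a (clamp s)))) * / 2).
  + apply continuity_mult; [apply continuity_plus|].
    * exact Ha.
    * exact (continuity_comp _ Rabs Ha Rcontinuity_abs).
    * apply continuity_const; now intros ? ?.
  + apply functional_extensionality; intros s; unfold m, Rmax, Rabs.
    destruct (Rle_dec _ 0), (Rcase_abs _); lra.
- intros s; apply Rmax_r.
- intros s Hs; apply (is_derive_clamp Re); [easy|apply Hd, Hs].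
- intros s Hs; apply (is_derive_clamp Im); [easy|apply Hd, Hs].
- intros s Hs; unfold m; rewrite clamp_id by (unfold I11; lra).
  rewrite <- HC.
  replace (Re (e s) ^ 2 + Im (e s) ^ 2) with (Cmod (e s) ^ 2).
  + apply Re_conj_mult_le, HG, Hs.
  + rewrite HC, pow2_sqrt; [easy|nra].
- rewrite clamp_id by (unfold I11; lra); now rewrite He0.
- rewrite clamp_id by (unfold I11; lra); now rewrite He0.
Qed.

(** * The error bound *)

Theorem theorem3 (N : nat) (a u y p dp : R -> C) (y0 : C)
  (hN : (1 <= N)%nat)
  (ha : continuous_on I11 a) (hu : continuous_on I11 u)
  (hy : continuous_on I11 y)
  (hy_ode : forall t : R, I11 t -> is_derive_on I11 y t (a t * y t + u t)%C)
  (hy_init : y (-1) = y0)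
  (hp : is_poly N p)
  (hdp : forall t : R, I11 t -> is_derive_on I11 p t (dp t))
  (hp_col : forall j : nat, (j < N)%nat ->
     dp (cheb_pt N j)
     = (a (cheb_pt N j) * p (cheb_pt N j) + u (cheb_pt N j))%C)
  (hp_init : p (-1) = y0) :
  let Ca : R := exp (RInt (fun s => Rmax (Re (a s)) 0) (-1) 1) in
  let Rp : C := (dp (-1)%R - a (-1)%R * y0 - u (-1)%R)%C in
  let ap : R -> C := fun t => (a t * p t)%C in
  norm_sup (fun t => y t - p t)%C
  <= 2 * Ca * (norm_sup (fun t => ap t - cheb_interp N ap t)%C
               + norm_sup (fun t => u t - cheb_interp N u t)%C
               + Cmod Rp).
Proof.
intros Ca Rp ap.
destruct (is_poly_derive_on N p dp hp hdp) as [q [Hq Hdq]].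
destruct (cheb_interpP N ap) as [Pap Iap], (cheb_interpP N u) as [Pu Iu].
assert (Hm1 : I11 (-1)) by (unfold I11; lra).
(* The factor 1 fits the sum to [is_poly_lin]. *)
assert (Hdefect : forall t, I11 t ->
  Cmod (dp t - (cheb_interp N ap t + 1 * cheb_interp N u t))%C <= Cmod Rp).
{ intros t Ht; rewrite (Hdq t Ht).
  eapply Rle_trans;
    [apply (poly_defect_le_endpoint N q
       (fun s => cheb_interp N ap s + 1 * cheb_interp N u s)%C)|];
    try easy.
  - now apply is_poly_lin.
  - intros j Hj; rewrite <- Hdq by apply cheb_pt_I11.
    rewrite hp_col, Iap, Iu by lia; unfold ap; ring.
  - right; apply f_equal.
    rewrite <- (Hdq _ Hm1), <- (cheb_pt_last N hN), Iap, Iu by lia.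
    unfold ap, Rp; rewrite (cheb_pt_last N hN), hp_init; ring. }
assert (Ca' := continuous_on_clamped a ha).
assert (Cu := continuous_on_clamped u hu).
assert (Cy := continuous_on_clamped y hy).
assert (Cp := is_poly_clamped_continuous N p hp).
apply norm_sup_le, (linear_ode_bound a (fun t => y t - p t)%C
  (fun t => a t * y t + u t - dp t)%C).
- exact Ca'.
- now apply clamped_continuous_minus.
- intros t Ht; assert (Ht' : I11 t) by (unfold I11; lra).
  destruct (is_derive_on_components _ _ _ Ht' (hy_ode t Ht')) as [Y1 Y2].
  destruct (is_derive_on_components _ _ _ Ht' (hdp t Ht')) as [P1 P2].
  apply is_derive_I_interior in Y1, Y2, P1, P2; try easy.
  split; [exact (is_derive_minus _ _ _ _ _ Y1 P1)
         |exact (is_derive_minus _ _ _ _ _ Y2 P2)].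
- intros t Ht; assert (Ht' : I11 t) by (unfold I11; lra).
  replace (a t * y t + u t - dp t - a t * (y t - p t))%C with
    ((ap t - cheb_interp N ap t) + (u t - cheb_interp N u t)
     + - (dp t - (cheb_interp N ap t + 1 * cheb_interp N u t)))%C
    by (unfold ap; ring).
  eapply Rle_trans; [apply Cmod_triangle|].
  rewrite Cmod_opp; apply Rplus_le_compat; [|now apply Hdefect].
  eapply Rle_trans; [apply Cmod_triangle|].
  apply Rplus_le_compat.
  + apply (Cmod_le_norm_sup (fun s => ap s - cheb_interp N ap s)%C); [|easy].
    apply clamped_continuous_minus;
      [now apply clamped_continuous_mult
      |now apply (is_poly_clamped_continuous N)].
  + apply (Cmod_le_norm_sup (fun s => u s - cheb_interp N u s)%C); [|easy].
    apply clamped_continuous_minus;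
      [easy|now apply (is_poly_clamped_continuous N)].
- cbv beta; rewrite hy_init, hp_init; ring.
Qed.
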